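(* Let $2<p<\infty$ and $\frac1p+\frac1q=1$. Let $\bar x=(\bar t_1,\bar t_2,\dots)\in l_p\setminus\{\theta\}$ with $1\le|\mathcal N(\bar x)|<\infty$. Then the normalized duality mapping $J:l_p\to l_q$ is Fréchet differentiable at $\bar x$. For any $v=\{s_n\}_{n=1}^\infty\in l_p\setminus\{\theta\}$ with ratio sequence $\{\lambda_n\}_{n=1}^\infty$ with respect to $\bar x$, one has $$\nabla J(\bar x)(v)=J'(\bar x)(v)=J(\bar x)\left((p-1)\begin{pmatrix}\lambda_1&0&\cdots\\0&\lambda_2&0\\\vdots&0&\ddots\end{pmatrix}-\frac{(p-2)\sum_{i=1}^\infty\lambda_i|\bar t_i|^p}{\sum_{i=1}^\infty|\bar t_i|^p}\begin{pmatrix}1&0&\cdots\\0&1&0\\\vdots&0&\ddots\end{pmatrix}\right).$$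
   Context: $(l_p,\|\cdot\|_p)$ and $(l_q,\|\cdot\|_q)$ are the real sequence spaces, $l_p^*=l_q$, $\theta=(0,0,\dots)$. The normalized duality mapping $J:l_p\to l_q$ is given by $J(\theta)=\theta$ and, for $x=(t_1,t_2,\dots)\neq\theta$, $J(x)=\left\{\frac{|t_n|^{p-1}\mathrm{sign}(t_n)}{\|x\|_p^{p-2}}\right\}_{n=1}^\infty$. For a real sequence $x=(t_n)$, $\mathcal N(x)=\{n\in\mathbb N:t_n\ne0\}$ and $|\mathcal N(x)|$ is its cardinality. For real sequences $\bar x=(\bar t_n)$ and $v=(s_n)$, the ratio sequence $\{\lambda_n\}$ of $v$ with respect to $\bar x$ is defined by $\lambda_n=0$ if $\bar t_n=0$ and $\lambda_n=s_n/\bar t_n$ if $\bar t_n\ne0$. A sequence times an infinite diagonal matrix is computed as a row vector times the matrix (entrywise multiplication by the diagonal entries). $J'(\bar x)(v)=\lim_{t\to0}\frac{J(\bar x+tv)-J(\bar x)}{t}$ (limit in $l_q$, $t$ real) is the Gâteaux derivative. $J$ is Fréchet differentiable at $\bar x$ with Fréchet derivative $\nabla J(\bar x)$ if $\nabla J(\bar x):l_p\to l_q$ is a continuous linear map with $\lim_{u\to\theta}\frac{J(\bar x+u)-J(\bar x)-\nabla J(\bar x)(u)}{\|u\|_p}=\theta$ in $l_q$. *)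

(* Defs.v *)
From HB Require Import structures.
From mathcomp Require Import all_boot all_order all_algebra.
From mathcomp Require Import all_classical all_reals all_analysis.

Set Implicit Arguments.
Unset Strict Implicit.
Unset Printing Implicit Defensive.

Import Order.TTheory GRing.Theory Num.Theory.
Import numFieldNormedType.Exports.

Local Open Scope classical_set_scope.
Local Open Scope ring_scope.

(* l_p as L^p(nat, counting measure), with sequences indexed from 0; by
   Lnorm_counting, lp_norm x is (\sum_(k <oo) `|x k| `^ p) `^ p^-1. *)
Definition lp (R : realType) (p : R) (p1 : (1 <= p%:E)%E) : Type :=
  LfunType (@counting nat R) p1.

Section lp_normed.
Context (R : realType) (p : R) (p1 : (1 <= p%:E)%E).

HB.instance Definition _ := GRing.Lmodule.on (lp p1).

Definition lp_norm (x : lp p1) : R := fine 'N[@counting nat R]_p%:E[EFin \o x].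

Let lp_normD (x y : lp p1) : lp_norm (x + y) <= lp_norm x + lp_norm y.
Proof. exact: ler_LnormD. Qed.

Let lp_normZ (a : R) (x : lp p1) : lp_norm (a *: x) = `|a| * lp_norm x.
Proof. by rewrite /lp_norm LnormZ -finite_norm_fine. Qed.

Let lp_norm_eq0 (x : lp p1) : lp_norm x = 0 -> x = 0.
Proof.
move=> /fine_Lnormr_eq0[A [mA A0 sA]]; apply/LfuneqP => n.
apply: contrapT => xn; have An : A n by apply: sA => /= /(_ I).
suff /eqP : (@counting nat R [set n] <= 0)%E.
  by rewrite measure_le0 /= /counting asboolT// fset_set1 finmap.cardfs1 eqe oner_eq0.
by rewrite -A0 le_measure ?inE// => _ ->.
Qed.

HB.instance Definition _ := @Lmodule_isNormed.Build R (lp p1) lp_norm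
  lp_normD lp_normZ lp_norm_eq0.

End lp_normed.

Lemma gt2_ge1 (R : realType) (p : R) : 2 < p -> (1 <= p%:E)%E.
Proof. by move=> p2; rewrite lee_fin ltW// (lt_trans _ p2)// ltr1n. Qed.

Lemma conj_ge1 (R : realType) (p q : R) :
  2 < p -> p^-1 + q^-1 = 1 -> (1 <= q%:E)%E.
Proof.
move=> p2 pq; have p0 : 0 < p by apply: lt_trans p2.
have ip : p^-1 < 1 by rewrite invf_lt1// (lt_trans _ p2)// ltr1n.
have iq : q^-1 = 1 - p^-1 by rewrite -pq addrAC subrr add0r.
have q0 : 0 < q by rewrite -invr_gt0 iq subr_gt0.
by rewrite lee_fin -invf_le1// iq gerBl invr_ge0 ltW.
Qed.

Section duality_map.
Context (R : realType) (p q : R).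
Context (p1 : (1 <= p%:E)%E) (q1 : (1 <= q%:E)%E) (pq : p^-1 + q^-1 = 1).

Definition duality_seq (x : lp p1) : nat -> R := fun n =>
  if x == 0 then 0 else `|x n| `^ (p - 1) * Num.sg (x n) / `|x| `^ (p - 2).

Lemma duality_seq_Lfun (x : lp p1) :
  duality_seq x \in Lfun (@counting nat R) q%:E.
Proof.
have p0 : 0 < p by apply: (lt_le_trans ltr01); rewrite -lee_fin.
have q0 : 0 < q by apply: (lt_le_trans ltr01); rewrite -lee_fin.
have pqE : (p - 1) * q = p.
  have /(congr1 (fun z => z * (p * q))) := pq.
  rewrite mulrDl mul1r mulrA mulVf ?gt_eqF// mul1r mulrCA mulVf ?gt_eqF// mulr1.
  by move=> h; rewrite mulrBl mul1r -h addrAC subrr add0r.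
have xoo : (\sum_(k <oo) `|(x k)%:E| `^ p < +oo)%E.
  have : ('N[@counting nat R]_p%:E[EFin \o x] < +oo)%E by exact: Lfunction_finite.
  rewrite Lnorm_counting//; apply: lty_poweRy.
  by rewrite gt_eqF// invr_gt0.
rewrite inE; apply/andP; split; first by rewrite inE.
rewrite inE/= /finite_norm Lnorm_counting//; apply: poweR_lty.
pose c : R := (`|x| `^ (p - 2))^-1 `^ q.
have c0 : 0 <= c by exact: powR_ge0.
apply: (@le_lt_trans _ _ (\sum_(k <oo) c%:E * `|(x k)%:E| `^ p)%E); last first.
  rewrite nneseriesZl; last by move=> *; exact: poweR_ge0.
  by rewrite lte_mul_pinfty.
apply: lee_nneseries => [k _ _|k _]; first exact: poweR_ge0.
change ((`|duality_seq x k| `^ q)%:E <= (c * `|x k| `^ p)%:E)%E.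
rewrite lee_fin /duality_seq.
case: ifPn => _.
  by rewrite normr0 powR0 ?gt_eqF// mulr_ge0// powR_ge0.
rewrite !normrM normfV !(ger0_norm (powR_ge0 _ _)) mulrC.
rewrite powRM ?invr_ge0 ?powR_ge0// ?mulr_ge0 ?powR_ge0//.
rewrite ler_wpM2l// powRM ?powR_ge0// -powRrM pqE.
rewrite ler_piMr ?powR_ge0// normr_sg.
by case: (x k != 0); rewrite ?powR1// powR0 ?gt_eqF.
Qed.

Definition duality (x : lp p1) : lp q1 := Lfun_Sub q1 (duality_seq_Lfun x).

Lemma dualityE (x : lp p1) : duality x = duality_seq x :> (nat -> R).
Proof. by []. Qed.

End duality_map.

Section sequences.
Context (R : realType).
Implicit Types (x v lambda : nat -> R) (A : nat -> nat -> R).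

Definition supp x : set nat := [set n | x n != 0].

Definition ratio_seq v x : nat -> R :=
  fun n => if x n == 0 then 0 else v n / x n.

Definition diag_infmx lambda : nat -> nat -> R :=
  fun i j => if i == j then lambda i else 0.

Definition row_mul_infmx x A : nat -> R :=
  fun j => limn (series (fun i => x i * A i j)).

Lemma row_mul_diag x lambda j :
  row_mul_infmx x (diag_infmx lambda) j = x j * lambda j.
Proof.
apply: cvg_lim => //; apply: cvg_near_cst.
exists j.+1 => //= n /= jn; apply/eqP; rewrite seriesEord/= (bigD1 (Ordinal jn))//=.
rewrite /diag_infmx eqxx big1 ?addr0// => i ij.
by case: eqP => [ijE|_]; rewrite ?mulr0//; case/eqP: ij; apply: val_inj.
Qed.

End sequences.

(* Main.v *)
From HB Require Import structures.
Require Import Defs.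
From mathcomp Require Import all_boot all_order all_algebra.
From mathcomp Require Import all_classical all_reals all_analysis.
From mathcomp Require Import ring.

Import Order.TTheory GRing.Theory Num.Theory.
Import numFieldNormedType.Exports.

Local Open Scope classical_set_scope.
Local Open Scope ring_scope.

(** Write [p' = p - 1].  Off the origin, the [k]-th coordinate of [J x] is the
    product of the weight [|x|^-(p - 2)], common to all coordinates, and of the
    signed power [|x_k|^p' sgn x_k]; signed powers with exponent greater than 1
    are differentiable on the whole line, also at 0.  Two things stand between
    this remark and Frechet differentiability: the weight depends on infinitely
    many coordinates, and so does the norm of the target space.

    Both are settled by cutting sequences at a rank [N] beyond which [xbar]
    vanishes.  For the tail beyond [N] one has
    [tail y = tail (y - xbar)], hence
    [|tail y| <= |y - xbar|], so that everything which depends on a power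
    greater than 1 of [|tail y|] is [o(|y - xbar|)] and has a zero differential
    (superlinear_is_diff).  This applies twice:
    - [|y|^p] is a finite sum of the [|y_k|^p] plus [|tail y|^p], with [p > 1];
      its differential is therefore the finite sum one expects
      (is_diff_powR_lp_norm), and the weight is a power of [|y|^p];
    - the tail of [J y] has norm [weight * |tail y|^p'], with [p' > 1]
      (norm_drop_duality); what remains of [J y] is a finite combination of
      fixed unit sequences with real coefficients, each of them differentiable
      (differentiable_duality).

    Coordinates being continuous linear forms, the differential of [J] is then
    read off coordinate by coordinate from the product rule
    (diff_duality_coord).  Dividing by [xbar_k] where it is nonzero turns
    these values into the diagonal form of the theorem; where [xbar_k = 0] both
    sides vanish, since [p > 2]. *)

(** * Differentials of superlinear remainders and of signed powers *)

Section Differentials.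
Context {R : realType}.

(** An increment bounded by a power [r > 1] of the displacement is negligible
    with respect to it: this disposes of all the tails below. *)
Lemma superlinear_is_diff (V W : normedModType R) (f : V -> W) (x : V)
    (c r : R) :
  1 < r -> (\forall y \near x, `|f y - f x| <= c * `|y - x| `^ r) ->
  is_diff x f (fun=> 0).
Proof.
move=> r1 fx.
have r10 : 0 < r - 1 by rewrite subr_gt0.
have fx0 : \forall h \near (0 : V), `|f (h + x) - f x| <= c * `|h| `^ r.
  move: fx; rewrite (near_shift 0 x); apply: filterS => h /=.
  by rewrite subr0 addrK.
(* [diff_unique] wants a bundled linear map, hence the bundled zero map. *)
have @df : {linear V -> W} := @GRing.null_fun V W.
have cdf : continuous (df : V -> W) by move=> y; exact: cvg_cst.
have dfx : f \o shift x = cst (f x) + df +o_ 0 id.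
  apply/eqaddoP => _/posnumP[e].
  have cc : 0 < (`|c| + 1) by rewrite ltr_wpDl.
  near=> h.
  rewrite !fctE /= addr0.
  apply: (@le_trans _ _ (c * `|h| `^ r)); first by near: h.
  (* It suffices that [(|c| + 1) |h|^(r - 1) <= e]; adding 1 makes the factor
     invertible. *)
  have hr : `|h| `^ r = `|h| * `|h| `^ (r - 1).
    by rewrite mulr_powRB1// (lt_trans ltr01).
  rewrite hr mulrCA mulrC ler_wpM2r//.
  apply: (@le_trans _ _ ((`|c| + 1) * `|h| `^ (r - 1))).
    by rewrite ler_wpM2r ?powR_ge0// (le_trans (ler_norm c))// lerDl.
  rewrite mulrC -ler_pdivlMr//.
  have he : `|h| <= (e%:num / (`|c| + 1)) `^ (r - 1)^-1.
    near: h; apply: nbhs0_le; rewrite powR_gt0 ?divr_gt0//.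
  apply: (le_trans (ge0_ler_powR (ltW r10) _ _ he)); rewrite ?nnegrE ?powR_ge0//.
  by rewrite -powRrM mulVf ?gt_eqF// powRr1// ltW// divr_gt0.
have dE : 'd f x = df :> (V -> W) by exact: diff_unique.
apply: DiffDef => //.
by apply/diff_locallyP; rewrite dE.
Unshelve. all: by end_near. Qed.

(** The difference of the two functions vanishes near [x], so it is superlinear
    with constant 0. *)
Lemma near_is_diff (V W : normedModType R) (f g df : V -> W) (x : V) :
  (\forall y \near x, f y = g y) -> is_diff x f df -> is_diff x g df.
Proof.
move=> fg fdf.
have gf0 : is_diff x (g - f) (fun=> 0).
  apply: (@superlinear_is_diff _ _ _ _ 0 2); first by rewrite ltr1n.
  have fgx := nbhs_singleton fg.
  near=> y; rewrite !fctE mul0r normr_le0; apply/eqP.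
  by rewrite -fgx subrr subr0; apply/eqP; rewrite subr_eq0 eq_sym; apply/eqP; near: y.
have gE : g = f + (g - f) by rewrite addrC subrK.
rewrite gE; apply: (is_diff_eq (is_diffD fdf gf0)).
by apply/funext => h; rewrite !fctE addr0.
Unshelve. all: by end_near. Qed.

Lemma is_derive1_is_diff (g : R -> R) (a dg : R) :
  is_derive a 1 g dg -> is_diff a g (fun h => h * dg).
Proof.
move=> gdg; have gd : derivable g a 1 by exact: ex_derive.
apply: DiffDef; first exact/derivable1_diffP.
by rewrite deriv1E// derive1E derive_val.
Qed.

Definition sgpow (r x : R) : R := `|x| `^ r * Num.sg x.

Lemma sgpow_opp (r x : R) : sgpow r (- x) = - sgpow r x.
Proof. by rewrite /sgpow normrN sgrN mulrN. Qed.

(** Away from 0 this is the derivative of a power, transported to the negative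
    axis by oddness; at 0 the function is superlinear because [r > 1]. *)
Lemma is_derive1_sgpow (r a : R) :
  1 < r -> is_derive a 1 (sgpow r) (r * `|a| `^ (r - 1)).
Proof.
move=> r1.
have pos (b : R) : 0 < b -> is_derive b 1 (sgpow r) (r * b `^ (r - 1)).
  move=> b0; refine (@near_eq_is_derive R R R (fun z : R => z `^ r) (sgpow r) b 1 _ _ _).
    near=> y; have y0 : 0 < y by near: y; exact: lt_nbhsr.
    by rewrite /sgpow gtr0_norm// gtr0_sg// mulr1.
  exact: is_derive1_powR.
have [a0|a0|->] := ltgtP a 0.
- have -> : sgpow r = - (sgpow r \o -%R).
    by apply/funext => y; rewrite !fctE /= sgpow_opp opprK.
  have Na0 : 0 < - a by rewrite oppr_gt0.
  have := pos _ Na0 => dN.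
  rewrite ltr0_norm//.
  have dC := is_derive1_comp dN (is_deriveNid a 1).
  by apply: (is_derive_eq (is_deriveN dC)); rewrite mulrN1 opprK.
- by rewrite gtr0_norm//; exact: pos.
- have d0 : is_diff 0 (sgpow r) (fun=> 0).
    apply: (@superlinear_is_diff _ _ _ _ 1 r) => //.
    near=> y; rewrite /sgpow sgr0 mulr0 !subr0 mul1r normrM ger0_norm ?powR_ge0//.
    by rewrite ler_piMr ?powR_ge0// normr_sg lern1 leq_b1.
  rewrite normr0 powR0 ?subr_eq0 ?gt_eqF// mulr0.
  have dd : differentiable (sgpow r) 0 by [].
  apply: DeriveDef; first exact: diff_derivable.
  by rewrite deriveE// diff_val.
Unshelve. all: by end_near. Qed.

Lemma sgpowE (r x : R) : 0 < r -> sgpow r x = x * `|x| `^ (r - 1).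
Proof.
move=> r0.
rewrite /sgpow -[LHS](congr1 ( *%R^~ _) (mulr_powRB1 (normr_ge0 _) r0)).
by rewrite mulrAC [`|x| * _]mulrC -numEsg.
Qed.

Lemma powR_norm_sgpow (r x : R) : 0 < r -> `|x| `^ r = x * sgpow (r - 1) x.
Proof.
move=> r0; rewrite /sgpow mulrCA [x * _]mulrC -normrEsg mulrC.
by rewrite mulr_powRB1.
Qed.

(** Since [|x|^r] is [x] times the signed power of exponent [r - 1], the product
    rule covers the point 0 without a case analysis. *)
Lemma is_derive1_powR_norm (r a : R) :
  2 < r -> is_derive a 1 (fun x => `|x| `^ r) (r * sgpow (r - 1) a).
Proof.
move=> r2; have r0 : 0 < r by exact: lt_trans r2.
have r1 : 1 < r - 1 by rewrite ltrBrDr.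
have -> : (fun x => `|x| `^ r) = id * sgpow (r - 1).
  by apply/funext => x; rewrite powR_norm_sgpow.
have ds := is_derive1_sgpow _ a r1.
apply: is_derive_eq; rewrite /GRing.scale /= mulr1.
have -> : a * ((r - 1) * `|a| `^ (r - 1 - 1)) = (r - 1) * sgpow (r - 1) a.
  by rewrite sgpowE ?(lt_trans _ r1)// mulrCA.
by ring.
Qed.

End Differentials.

Lemma is_diff_sum {R : numFieldType} {V W : normedModType R} (n : nat)
    (f df : 'I_n -> V -> W) (x : V) :
  (forall i, is_diff x (f i) (df i)) ->
  is_diff x (fun y => \sum_(i < n) f i y) (fun h => \sum_(i < n) df i h).
Proof.
move=> dfx.
have sumE (g : 'I_n -> V -> W) :
    (fun y => \sum_(i < n) g i y) = \sum_(i < n) g i.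
  by apply/funext => y; rewrite fct_sumE.
rewrite !sumE.
elim/big_ind2: _ => [|f1 df1 f2 df2 d1 d2|i _]; last exact: dfx.
- exact: is_diff_cst.
- exact: is_diffD.
Qed.

(** * Coordinates and tails of p-summable sequences *)

Section LpCoordinates.
Context {R : realType} {p : R} {p1 : (1 <= p%:E)%E}.
Implicit Types x y : lp p1.

Let p0 : 0 < p.
Proof. by apply: (lt_le_trans ltr01); rewrite -lee_fin. Qed.

Lemma powR_lp_norm x : (`|x| `^ p)%:E = (\sum_(k <oo) (`|x k| `^ p)%:E)%E.
Proof.
have s0 : (0 <= \sum_(k <oo) (`|x k| `^ p)%:E)%E.
  by apply: nneseries_ge0 => k _ _; rewrite lee_fin powR_ge0.
rewrite -poweR_EFin.
have -> : (`|x|%:E = (\sum_(k <oo) (`|x k| `^ p)%:E) `^ p^-1)%E.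
  rewrite [LHS](finite_norm_fine x) Lnorm_counting//.
by rewrite -poweRrM mulVf ?gt_eqF// poweRe1.
Qed.

Lemma counting_Lfun (f : nat -> R) :
  (\sum_(k <oo) (`|f k| `^ p)%:E < +oo)%E -> f \in Lfun (@counting nat R) p%:E.
Proof.
move=> foo; rewrite inE; apply/andP; split; first by rewrite inE.
by rewrite inE/= /finite_norm Lnorm_counting//; apply: poweR_lty.
Qed.

Lemma unit_seq_Lfun (k : nat) :
  (fun n => (n == k)%:R : R) \in Lfun (@counting nat R) p%:E.
Proof.
apply: counting_Lfun.
rewrite (nneseries_split 0 k.+1); last by move=> *; rewrite lee_fin powR_ge0.
rewrite add0n eseries0 ?adde0; last first.
  move=> n kn _; rewrite gtn_eqF//= normr0 powR0 ?gt_eqF//.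
by rewrite sumEFin ltry.
Qed.

Definition unit_seq (k : nat) : lp p1 := Lfun_Sub p1 (unit_seq_Lfun k).

(** The tail from rank [N] on is defined by subtracting the head, so that it lies
    in the space and splits every vector into a finite combination of fixed unit
    sequences and a tail; [drop_seqE] gives its entries. *)
Definition drop_seq (N : nat) x : lp p1 := x - \sum_(k < N) x k *: unit_seq k.

Lemma lp_sumE (I : Type) (s : seq I) (F : I -> lp p1) n :
  (\sum_(i <- s) F i) n = \sum_(i <- s) F i n.
Proof.
by elim/big_rec2: _ => // i _ y _ <-.
Qed.

Lemma drop_seqE N x n : drop_seq N x n = if (n < N)%N then 0 else x n.
Proof.
have -> : drop_seq N x n = x n - \sum_(k < N) x k * (n == k)%:R.
  by rewrite -(lp_sumE _ _ (fun k : 'I_N => x k *: unit_seq k)).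
case: ltnP => nN.
  rewrite (bigD1 (Ordinal nN))//= eqxx mulr1 big1 ?addr0 ?subrr// => i ni.
  rewrite (_ : (n == i) = false) ?mulr0//.
  by apply/negbTE; apply: contra ni => /eqP ni; apply/eqP/val_inj.
rewrite big1 ?subr0// => i _; rewrite gtn_eqF ?mulr0//.
exact: leq_trans nN.
Qed.

Lemma drop_seqB N x y : drop_seq N (x - y) = drop_seq N x - drop_seq N y.
Proof.
apply/LfuneqP => n; rewrite drop_seqE.
rewrite [RHS](_ : _ = drop_seq N x n - drop_seq N y n)// !drop_seqE.
by case: ifP; rewrite ?subr0.
Qed.

Lemma drop_seq_eq0 N x : (forall k, (N <= k)%N -> x k = 0) -> drop_seq N x = 0.
Proof.
by move=> xN; apply/LfuneqP => k; rewrite drop_seqE; case: ltnP => // /xN.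
Qed.

Lemma powR_lp_norm_split N x :
  `|x| `^ p = \sum_(k < N) `|x k| `^ p + `|drop_seq N x| `^ p.
Proof.
apply: EFin_inj; rewrite EFinD !powR_lp_norm -sumEFin.
have s0 (z : lp p1) k : (0 <= (`|z k| `^ p)%:E)%E by rewrite lee_fin powR_ge0.
rewrite [LHS](nneseries_split 0 N) => [|k _]; last exact: s0.
rewrite add0n big_mkord; congr (_ + _)%E.
rewrite [RHS](nneseries_split 0 N) => [|k _]; last exact: s0.
rewrite add0n big_mkord big1; last first.
  by move=> i _; rewrite drop_seqE ltn_ord normr0 powR0 ?gt_eqF.
rewrite add0e !ereal_series; apply: eq_eseriesr => k Nk.
by rewrite drop_seqE ltnNge Nk.
Qed.

Lemma norm_drop_seq N x : `|drop_seq N x| <= `|x|.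
Proof.
rewrite leNgt; apply/negP => /(gt0_ltr_powR p0).
rewrite !nnegrE !normr_ge0 => /(_ isT isT); apply/negP; rewrite -leNgt.
by rewrite (powR_lp_norm_split N x) lerDr sumr_ge0// => *; exact: powR_ge0.
Qed.

Lemma norm_coord x (k : nat) : `|x k| <= `|x|.
Proof.
rewrite leNgt; apply/negP => /(gt0_ltr_powR p0).
rewrite !nnegrE !normr_ge0 => /(_ isT isT); apply/negP; rewrite -leNgt.
rewrite (powR_lp_norm_split k.+1 x) big_ord_recr/= addrAC lerDr addr_ge0//.
by rewrite sumr_ge0// => *; exact: powR_ge0.
Qed.

(** A coordinate is a linear form bounded by the norm, hence its own
    differential. *)
Lemma is_diff_coord (k : nat) x : is_diff x (fun y : lp p1 => y k) (fun h => h k).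
Proof.
pose f (y : lp p1) : R := y k.
have flin : linear f by [].
pose fL : {linear lp p1 -> R} :=
  HB.pack f (GRing.isLinear.Build _ _ _ _ f flin).
have fcont : continuous fL.
  apply/linear_bounded_continuous/linear_boundedP.
  apply: filterS (nbhs_pinfty_ge (num_real (1 : R))) => r r1 y.
  by rewrite (le_trans (norm_coord y k))// ler_peMl.
have fd := linear_differentiable x fcont.
have fE := diff_lin x fcont.
exact: (DiffDef _ fd fE).
Qed.

End LpCoordinates.

(** * The p-th power of the norm at a finitely supported point *)

Section NormPower.
Context {R : realType} {p : R} {p1 : (1 <= p%:E)%E} (p2 : 2 < p).

(** Only the head of the sequence contributes to the differential: at a point
    that vanishes from rank [N] on, the tail is superlinear. *)
Lemma is_diff_powR_lp_norm (N : nat) (x : lp p1) :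
  (forall k, (N <= k)%N -> x k = 0) ->
  is_diff x (fun y : lp p1 => `|y| `^ p)
    (fun h => \sum_(k < N) h k * (p * sgpow (p - 1) (x k))).
Proof.
move=> xN; have p0 : 0 < p by exact: lt_trans p2.
have dropx : drop_seq N x = 0 by exact: drop_seq_eq0.
have dt : is_diff x (fun y : lp p1 => `|drop_seq N y| `^ p) (fun=> 0).
  apply: (@superlinear_is_diff _ _ _ _ _ 1 p); first by rewrite (lt_trans _ p2)// ltr1n.
  near=> y; rewrite dropx normr0 powR0 ?gt_eqF// subr0 mul1r ger0_norm ?powR_ge0//.
  (* The tail of [x] is zero, so the tail of [y] is that of [y - x]. *)
  rewrite -[drop_seq N y]subr0 -dropx -drop_seqB.
  by apply: ge0_ler_powR; rewrite ?nnegrE ?(ltW p0)//; exact: norm_drop_seq.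
have dh : is_diff x (fun y : lp p1 => \sum_(k < N) `|y k| `^ p)
    (fun h => \sum_(k < N) h k * (p * sgpow (p - 1) (x k))).
  apply: is_diff_sum => k.
  exact: (is_diff_comp (is_diff_coord k x)
    (is_derive1_is_diff _ _ _ (is_derive1_powR_norm _ (x k) p2))).
have -> : (fun y : lp p1 => `|y| `^ p) =
    (fun y : lp p1 => \sum_(k < N) `|y k| `^ p) + (fun y => `|drop_seq N y| `^ p).
  by apply/funext => y; rewrite (powR_lp_norm_split N y).
apply: (is_diff_eq (is_diffD dh dt)).
by apply/funext => h; rewrite !fctE addr0.
Unshelve. all: by end_near. Qed.

End NormPower.

(** * Differentiability of the duality map *)

Section Duality.
Context {R : realType} {p q : R} (p2 : 2 < p) (pq : p^-1 + q^-1 = 1).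
Notation lpp := (lp (gt2_ge1 p2)).
Let J : lpp -> lp (conj_ge1 p2 pq) := duality (conj_ge1 p2 pq) pq.

Let p0 : 0 < p. Proof. exact: lt_trans p2. Qed.
Let r1 : 1 < p - 1. Proof. by rewrite ltrBrDr. Qed.

(** This is [|x|^-(p - 2)], written as a power of [|x|^p] because the latter is
    the function of [x] whose differential is known. *)
Definition duality_weight (x : lpp) : R := (`|x| `^ p) `^ (- ((p - 2) / p)).

Lemma duality_coord (x : lpp) (k : nat) :
  x != 0 -> J x k = duality_weight x * sgpow (p - 1) (x k).
Proof.
move=> x0; rewrite dualityE /duality_seq (negbTE x0) mulrC.
by rewrite /duality_weight -powRrM mulrN [p * _]mulrC divfK ?gt_eqF// powRN.
Qed.

(** The identity is the equality of [q]-th powers: as [(p - 1) q = p], these are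
    the same series up to the factor [duality_weight x ^ q]. *)
Lemma norm_drop_duality (N : nat) (x : lpp) : x != 0 ->
  `|drop_seq N (J x)| = duality_weight x * `|drop_seq N x| `^ (p - 1).
Proof.
move=> x0.
have q0 : 0 < q.
  by have := conj_ge1 p2 pq; rewrite lee_fin; exact: lt_le_trans.
have pqE : (p - 1) * q = p.
  have : (p - 1) * q - p = p * q * (1 - (p^-1 + q^-1)) by field; rewrite !gt_eqF.
  by rewrite pq subrr mulr0 => /eqP; rewrite subr_eq0 => /eqP.
have w0 : 0 <= duality_weight x by exact: powR_ge0.
apply: (powR_injective q0); rewrite ?nnegrE ?mulr_ge0 ?powR_ge0//.
rewrite powRM ?powR_ge0// -powRrM pqE.
apply: EFin_inj; rewrite EFinM !powR_lp_norm -nneseriesZl; last first.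
  by move=> *; rewrite lee_fin powR_ge0.
apply: eq_eseriesr => k _; rewrite -EFinM !drop_seqE.
case: ifP => _; first by rewrite normr0 !powR0 ?mulr0 ?gt_eqF.
rewrite duality_coord// normrM powRM// ger0_norm//.
congr (_ * _)%:E; rewrite /sgpow normrM ger0_norm ?powR_ge0// normr_sg.
have [->|xk0] := eqVneq (x k) 0.
  by rewrite mulr0 normr0 !powR0// gt_eqF.
by rewrite mulr1 -powRrM pqE.
Qed.

Section AtFiniteSupport.
Context (x : lpp) (x0 : x != 0) (N : nat).
Context (xN : forall k, (N <= k)%N -> x k = 0).

Let a := - ((p - 2) / p).

Let near_neq0 : \forall y \near x, y != 0.
Proof. exact: (cvgr_neq0 x (cvg_id : id @ x --> x) x0). Qed.

Definition duality_weight_diff (h : lpp) : R :=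
  (\sum_(k < N) h k * (p * sgpow (p - 1) (x k))) *
  (a * (`|x| `^ p) `^ (a - 1)).

Lemma is_diff_duality_weight :
  is_diff x duality_weight duality_weight_diff.
Proof.
have M0 : 0 < `|x| `^ p by rewrite powR_gt0// normr_gt0.
exact: (is_diff_comp (is_diff_powR_lp_norm p2 N x xN)
  (is_derive1_is_diff _ _ _ (is_derive1_powR a M0))).
Qed.

Definition duality_coord_diff (k : nat) (h : lpp) : R :=
  duality_weight x * (h k * ((p - 1) * `|x k| `^ (p - 1 - 1)))
  + sgpow (p - 1) (x k) * duality_weight_diff h.

Lemma is_diff_duality_coord (k : nat) :
  is_diff x (fun y => J y k) (duality_coord_diff k).
Proof.
apply: (@near_is_diff _ _ _
    (duality_weight * (sgpow (p - 1) \o (fun y : lpp => y k)))).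
  near=> y; rewrite duality_coord//.
  near: y; exact: near_neq0.
have ds := is_diff_comp (is_diff_coord k x)
  (is_derive1_is_diff _ _ _ (is_derive1_sgpow _ (x k) r1)).
exact: (is_diffM is_diff_duality_weight ds).
Unshelve. all: by end_near. Qed.

(** [J] is the sum of a head, whose coefficients on the unit sequences are
    differentiable real functions, and of a tail, whose norm is of order
    [p - 1 > 1] since the weight is bounded near [x]. *)
Lemma differentiable_duality : differentiable J x.
Proof.
have drop_small : is_diff x (fun y => drop_seq N (J y)) (fun=> 0).
  have dropx : drop_seq N x = 0 by exact: drop_seq_eq0.
  have dropJx : drop_seq N (J x) = 0.
    apply/normr0_eq0; rewrite norm_drop_duality// dropx normr0.
    by rewrite powR0 ?mulr0// gt_eqF// (lt_trans _ r1).
  apply: (@superlinear_is_diff _ _ _ _ _ (duality_weight x + 1) (p - 1)) => //.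
  near=> y; rewrite dropJx subr0 norm_drop_duality; last first.
    by near: y; exact: near_neq0.
  apply: ler_pM; rewrite ?powR_ge0//.
    (* The weight is continuous at [x], so it stays below its value plus 1. *)
    apply: ltW; near: y; apply: (@cvgr_lt _ _ _ _ duality_weight (duality_weight x)).
      have wd := is_diff_duality_weight.
      by apply: differentiable_continuous; exact: ex_diff.
    by rewrite ltrDl.
  rewrite -[drop_seq N y]subr0 -dropx -drop_seqB.
  apply: ge0_ler_powR; rewrite ?nnegrE ?norm_drop_seq//.
  by rewrite (le_trans _ (ltW r1)).
have Jsplit : J = (\sum_(k < N) (fun y => J y k *: unit_seq k)) +
    (fun y => drop_seq N (J y)).
  by apply/funext => y; rewrite !fctE fct_sumE /drop_seq addrC subrK.
rewrite Jsplit; apply: differentiableD; last exact: ex_diff.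
apply: differentiable_sum => k; apply: differentiableZl.
by have := is_diff_duality_coord k; move=> [].
Unshelve. all: by end_near. Qed.

(** The chain rule with the [k]-th coordinate, a linear form, and uniqueness of
    the differential of [y |-> J y k]. *)
Lemma diff_duality_coord (h : lpp) (k : nat) :
  'd J x h k = duality_coord_diff k h.
Proof.
have dJ : is_diff x J ('d J x) by apply: DiffDef; first exact: differentiable_duality.
have dJk := is_diff_comp dJ (is_diff_coord k (J x)).
have /(congr1 (fun f => f h)) := @diff_val _ _ _ _ _ _ _ dJk.
rewrite [X in X h = _ -> _](@diff_val _ _ _ _ _ _ _ (is_diff_duality_coord k)).
by move=> ->.
Qed.

End AtFiniteSupport.
End Duality.

(** * The differential in diagonal form *)

Lemma limn_series_finite {R : realType} (N : nat) (u : nat -> R) :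
  (forall k, (N <= k)%N -> u k = 0) -> limn (series u) = \sum_(k < N) u k.
Proof.
move=> u0; apply: cvg_lim => //; apply: cvg_near_cst.
exists N => //= n /= Nn; apply/eqP; rewrite seriesEnat/=.
rewrite (big_cat_nat (leq0n N) Nn)//= big_mkord [X in _ + X]big_nat_cond [X in _ + X]big1 ?addr0//.
by move=> k /andP[/andP[Nk _] _]; exact: u0.
Qed.

Lemma finite_supp_bounded {R : realType} (x : nat -> R) :
  finite_set (supp x) -> exists N, forall k, (N <= k)%N -> x k = 0.
Proof.
move=> /finite_seqP[s xs]; exists (\max_(i <- s) i).+1 => k sk.
apply/eqP; apply: contraTT sk => xk0; rewrite -ltnNge ltnS.
have : supp x k by [].
by rewrite xs => /= ks; exact: leq_bigmax_seq.
Qed.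

Theorem theorem4p4 (R : realType) (p q : R) (p2 : 2 < p)
    (pq : p^-1 + q^-1 = 1) (xbar : lp (gt2_ge1 p2)) (xbar0 : xbar != 0)
    (supp_ge1 : (`I_1 #<= supp xbar)%card) (supp_fin : finite_set (supp xbar)) :
  let J : lp (gt2_ge1 p2) -> lp (conj_ge1 p2 pq) :=
    duality (conj_ge1 p2 pq) pq in
  differentiable J xbar /\
  forall v : lp (gt2_ge1 p2), v != 0 ->
    let lambda := ratio_seq v xbar in
    [/\ derivable J xbar v,
        'd J xbar v = 'D_v J xbar
      & 'D_v J xbar = row_mul_infmx (J xbar)
          ((p - 1) *: diag_infmx lambda
           - ((p - 2) * limn (series (fun i => lambda i * `|xbar i| `^ p))
              / limn (series (fun i => `|xbar i| `^ p)))
             *: diag_infmx (fun=> 1))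
        :> (nat -> R)].
Proof.
move=> J.
have p0 : 0 < p by exact: (lt_trans _ p2).
have r1 : 1 < p - 1 by rewrite ltrBrDr.
have p10 : 0 < p - 1 by exact: lt_trans r1.
have [N xN] := finite_supp_bounded _ supp_fin.
have dJ : differentiable J xbar by exact: (differentiable_duality p2 pq xbar xbar0 N xN).
split=> // v _ lambda; split; [exact: diff_derivable | by rewrite deriveE |].
rewrite deriveE//; apply/funext => j.
rewrite [LHS](diff_duality_coord p2 pq xbar xbar0 N xN).
(* [M] is the [p]-th power of the norm and [p * L] its derivative along [v], so
   [L / M] is the logarithmic derivative of the norm. *)
set M := limn (series (fun i => `|xbar i| `^ p)).
set L := limn _.
have xp0 k : (N <= k)%N -> `|xbar k| `^ p = 0.
  by move=> /xN ->; rewrite normr0 powR0// gt_eqF.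
have ME : M = `|xbar| `^ p.
  rewrite /M (limn_series_finite N)// (powR_lp_norm_split N xbar).
  by rewrite (drop_seq_eq0 _ _ xN) normr0 powR0 ?addr0 ?gt_eqF.
have M0 : 0 < M by rewrite ME powR_gt0// normr_gt0.
have LE : L = \sum_(k < N) v k * sgpow (p - 1) (xbar k).
  rewrite /L (limn_series_finite N); last first.
    by move=> k Nk; rewrite xp0// mulr0.
  apply: eq_bigr => k _; rewrite powR_norm_sgpow// /lambda /ratio_seq.
  case: eqVneq => [->|xk0]; last by rewrite mulrA divfK.
  by rewrite /sgpow sgr0 !mulr0.
have -> : (p - 1) *: diag_infmx lambda
    - ((p - 2) * L / M) *: diag_infmx (fun=> 1) =
    diag_infmx (fun k => (p - 1) * lambda k - (p - 2) * L / M).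
  apply/funext => i; apply/funext => k.
  rewrite [LHS](_ : _ = (p - 1) * diag_infmx lambda i k
    - (p - 2) * L / M * diag_infmx (fun=> 1) i k)// /diag_infmx.
  by case: eqP => _; rewrite ?mulr1 ?mulr0 ?subr0.
rewrite row_mul_diag duality_coord// /duality_coord_diff /duality_weight_diff.
have -> : \sum_(k < N) v k * (p * sgpow (p - 1) (xbar k)) = p * L.
  by rewrite LE mulr_sumr; apply: eq_bigr => k _; rewrite mulrCA.
rewrite -ME.
have wE : M `^ (- ((p - 2) / p) - 1) = duality_weight p2 xbar / M.
  rewrite powRB ?powRr1 ?(ltW M0)//; last by rewrite (gt_eqF M0) implybT.
  by rewrite /duality_weight ME.
rewrite wE.
have -> : v j * ((p - 1) * `|xbar j| `^ (p - 1 - 1)) =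
    (p - 1) * lambda j * sgpow (p - 1) (xbar j).
  rewrite /lambda /ratio_seq; case: eqVneq => [->|xj0].
    by rewrite normr0 powR0 ?mulr0 ?mul0r// subr_eq0 gt_eqF.
  by rewrite sgpowE//; field.
by field; rewrite !gt_eqF.
Qed.
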